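(* Let $G=(V,w,m)$ be a finite connected weighted graph satisfying $CD(K,\infty)$ for some $K>0$, let $D:=\operatorname{Deg}_{\max}$, and let $0=\lambda_0<\lambda_1\le\lambda_2\le\dots$ be the eigenvalues of $-\Delta$ counted with multiplicity. Suppose $\lambda_{\deg_{\max}}=K$. Then: (1) $G$ has the hypercube shell structure $HSS\left(\frac{2D}K,\frac K2,x_0\right)$ for every $x_0\in V$; (2) $G$ has constant edge degree, i.e. there is $\kappa_0>0$ with $w(x,y)/m(x)\in\{0,\kappa_0\}$ for all $x,y\in V$.
   Context: A weighted graph is $G=(V,w,m)$ with $V$ countable, $w:V\times V\to[0,\infty)$ symmetric with $w(x,x)=0$, $m:V\to(0,\infty)$; $x\sim y$ iff $w(x,y)>0$. Laplacian $\Delta f(x)=\frac1{m(x)}\sum_y w(x,y)(f(y)-f(x))$ (self-adjoint on $\ell^2(V,m)$). $\operatorname{Deg}(x)=\frac1{m(x)}\sum_yw(x,y)$, $\operatorname{Deg}_{\max}=\max_x\operatorname{Deg}(x)$, $\deg(x)=\#\{y:y\sim x\}$, $\deg_{\max}=\max_x\deg(x)$. $d$ is the combinatorial graph distance. $2\Gamma(f,g)=\Delta(fg)-f\Delta g-g\Delta f$, $2\Gamma_2(f,g)=\Delta\Gamma(f,g)-\Gamma(f,\Delta g)-\Gamma(g,\Delta f)$, $\Gamma f=\Gamma(f,f)$, $\Gamma_2f=\Gamma_2(f,f)$; $CD(K,\infty)$ means $\Gamma_2f(x)\ge K\Gamma f(x)$ for all $f$ and $x$. $d_-^{x_0}(z)=\sum_{y\sim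 z,\ d(y,x_0)<d(z,x_0)}\frac{w(y,z)}{m(z)}$. Hypercube shell structure $HSS(N,W,x_0)$ ($N,W>0$): (i) $\operatorname{Deg}(x)=NW$ for all $x\in V$; (ii) $G$ is bipartite; (iii) $d_-^{x_0}(x)=W\,d(x,x_0)$ for all $x\in V$. *)

(* Defs.v *)
From HB Require Import structures.
From mathcomp Require Import all_boot all_order all_algebra.
Set Implicit Arguments. Unset Strict Implicit. Unset Printing Implicit Defensive.
Import Order.TTheory GRing.Theory Num.Theory.
Local Open Scope ring_scope.

Section WeightedGraph.
Variables (R : rcfType) (V : finType) (w : V -> V -> R) (m : V -> R).

Definition weighted_graph : Prop :=
  [/\ forall x y, w x y = w y x, forall x y, 0 <= w x y,
      forall x, w x x = 0 & forall x, 0 < m x].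

Definition adj (x y : V) : bool := 0 < w x y.

Definition connected : Prop := forall x y : V, connect adj x y.

Fixpoint reach (n : nat) (x y : V) : bool :=
  if n is n'.+1 then reach n' x y || [exists z, adj x z && reach n' z y]
  else x == y.

(* combinatorial graph distance (for connected graphs, d < #|V|) *)
Definition dist (x y : V) : nat := find (fun n => reach n x y) (iota 0 #|V|).

Definition Lap (f : V -> R) (x : V) : R :=
  (m x)^-1 * \sum_(y : V) w x y * (f y - f x).

Definition Gam (f g : V -> R) (x : V) : R :=
  (Lap (fun z => f z * g z) x - f x * Lap g x - g x * Lap f x) / 2.

Definition Gam2 (f g : V -> R) (x : V) : R :=
  (Lap (Gam f g) x - Gam f (Lap g) x - Gam g (Lap f) x) / 2.

Definition CD (K : R) : Prop :=
  forall (f : V -> R) (x : V), K * Gam f f x <= Gam2 f f x.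

Definition Deg (x : V) : R := (\sum_(y : V) w x y) / m x.
Definition Deg_max : R := \big[Num.max/0]_(x : V) Deg x.

Definition deg (x : V) : nat := #|[set y | adj y x]|.
Definition deg_max : nat := \max_(x : V) deg x.

Definition negLap_mx : 'M[R]_#|V| :=
  \matrix_(i, j) let x := enum_val i in let y := enum_val j in
     (i == j)%:R * Deg x - w x y / m x.

Definition eigen_list (s : seq R) : Prop :=
  sorted <=%R s /\ char_poly negLap_mx = \prod_(a <- s) ('X - a%:P).

Definition dminus (x0 z : V) : R :=
  \sum_(y : V | adj y z && (dist y x0 < dist z x0)%N) w y z / m z.

Definition bipartite : Prop :=
  exists c : V -> bool, forall x y, adj x y -> c x != c y.

Definition HSS (N W : R) (x0 : V) : Prop :=
  [/\ 0 < N, 0 < W, (forall x, Deg x = N * W), bipartite &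
      forall x, dminus x0 x = W * (dist x x0)%:R].

Definition const_edge_degree : Prop :=
  exists k0 : R, 0 < k0 /\ forall x y, w x y / m x = 0 \/ w x y / m x = k0.

End WeightedGraph.

(* Main.v *)
Require Import Defs.
From HB Require Import structures.
From mathcomp Require Import all_boot all_order all_algebra.
From mathcomp Require Import ring lra zify.
Set Implicit Arguments. Unset Strict Implicit. Unset Printing Implicit Defensive.
Import Order.TTheory GRing.Theory Num.Theory.
Local Open Scope ring_scope.

(** Integrating CD(K,∞) shows that every nonzero eigenvalue of [-Δ] is at least
    [K], and that an eigenfunction [f] for [K] satisfies [Γ₂ f = K Γ f]
    pointwise, so that [Γ f] is harmonic, hence constant.  Consequently an
    eigenfunction for [K] that is constant on the closed neighbourhood of one
    vertex [x] vanishes; since the eigenspace has dimension at least [deg_max],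
    the differences [f y - f x], [y ~ x], can be prescribed arbitrarily.
    As [f] is in the kernel of the nonnegative form [Γ₂ - K Γ], testing against
    the indicator of [z] with [d(x,z) = 2] yields
    [Σ_y w(x,y) w(y,z)/m(y) (f z - 2 f y + f x) = 0].  The eigenfunction with all
    differences at [x0] equal to [1] is therefore [f x0 + d(., x0)], and
    constancy of [Γ f] together with [Δ f = - K f] gives the shell structure.
    Reading condition (iii) at the neighbours of [x0] gives [w/m = K/2] on
    every edge. *)

(** * Matrices self-adjoint for a positive diagonal form *)

(** The [j]-th diagonal entry of [B^T D B = D B B = 0] is the sum over [k] of [d_k * B_kj ^ 2], a
    sum of nonnegative terms. *)
Lemma selfadjoint_sqr0 (R : realDomainType) n (d : 'rV[R]_n) (B : 'M[R]_n) :
    (forall i, 0 < d 0 i) -> diag_mx d *m B = B^T *m diag_mx d ->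
  B *m B = 0 -> B = 0.
Proof.
move=> d_gt0 symB BB0; have : B^T *m diag_mx d *m B = 0.
  by rewrite -symB -mulmxA BB0 mulmx0.
move=> /matrixP H; apply/matrixP => i j; rewrite mxE; apply/eqP.
have := H j j; rewrite !mxE => /eqP.
rewrite psumr_eq0 => [/allP/(_ i (mem_index_enum _))|k _];
  rewrite mul_mx_diag !mxE mulrAC -expr2.
  by rewrite mulf_eq0 (gt_eqF (d_gt0 i)) orbF sqrf_eq0.
by rewrite mulr_ge0 ?sqr_ge0 ?ltW.
Qed.

(** Since [k < 2 ^ k], some [2 ^ k]-th power vanishes. Powers of [B] stay self-adjoint, so the
    exponent can be halved repeatedly down to 1. *)
Lemma selfadjoint_nilpotent (R : realDomainType) n (d : 'rV[R]_n.+1)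
    (B : 'M[R]_n.+1) k :
    (forall i, 0 < d 0 i) -> diag_mx d *m B = B^T *m diag_mx d ->
  B ^+ k = 0 -> B = 0.
Proof.
move=> d_gt0 symB Bk0.
have {Bk0} : B ^+ (2 ^ k) = 0.
  by rewrite -(subnK (ltnW (ltn_expl k (ltnSn 1)))) exprD Bk0 mulr0.
elim: k => [|k IHk]; first by rewrite expr1.
rewrite expnSr exprM expr2 => sq0; apply: IHk.
apply: selfadjoint_sqr0 d_gt0 _ sq0.
elim: (2 ^ k)%N => [|l IHl]; first by rewrite expr0 trmx1 mulmx1 mul1mx.
by rewrite {1}exprS exprSr trmx_mul mulmxA symB -!mulmxA IHl.
Qed.

Lemma selfadjoint_horner (R : comNzRingType) n (d : 'rV[R]_n.+1)
    (A : 'M[R]_n.+1) p :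
    diag_mx d *m A = A^T *m diag_mx d ->
  diag_mx d *m horner_mx A p = (horner_mx A p)^T *m diag_mx d.
Proof.
move=> symA; elim/poly_ind: p => [|p c IHp].
  by rewrite !rmorph0 trmx0 mulmx0 mul0mx.
have -> : horner_mx A (p * 'X + c%:P) = horner_mx A p *m A + c%:M.
  by rewrite rmorphD rmorphM /= horner_mx_C horner_mx_X.
rewrite mulmxDr linearD /= mulmxDl tr_scalar_mx scalar_mxC; congr (_ + _).
rewrite {2}(comm_horner_mx p (erefl (A *m A))) trmx_mul.
by rewrite mulmxA IHp -!mulmxA symA.
Qed.

(* The radical of [char_poly A] is nilpotent at [A], hence zero there. *)
Lemma selfadjoint_diagonalizable (R : realFieldType) n (d : 'rV[R]_n.+1)
    (A : 'M[R]_n.+1) (s : seq R) :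
    (forall i, 0 < d 0 i) -> diag_mx d *m A = A^T *m diag_mx d ->
    char_poly A = \prod_(a <- s) ('X - a%:P) ->
  diagonalizable A.
Proof.
move=> d_gt0 symA cA; apply/diagonalizableP.
exists (undup s); first exact: undup_uniq.
set p := \prod_(_ <- _) _; apply: mxminpoly_min.
apply: (selfadjoint_nilpotent (k := size s) d_gt0 (selfadjoint_horner p symA)).
suff /dvdpP[q pq] : (char_poly A %| p ^+ size s)%R.
  by rewrite -rmorphXn /= pq rmorphM /= Cayley_Hamilton mulr0.
(* The induction on [s] runs over any list [t] containing [s], because [undup s] does not follow the
   recursion. *)
rewrite cA {}/p; have : {subset s <= undup s} by move=> x; rewrite mem_undup.
elim: s {cA} (undup s) => [|a s IHs] t st; first by rewrite big_nil dvd1p.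
rewrite big_cons exprS dvdp_mul ?IHs //; last first.
  by move=> x xs; rewrite st // inE xs orbT.
by rewrite dvdp_XsubCl root_prod_XsubC st // mem_head.
Qed.

(** By unique factorisation, [s] is a permutation of the diagonal entries of a diagonal form of [A].
    The rows of [P] at the entries equal to [a] are independent left eigenvectors. *)
Lemma diagonalizable_count_le (F : fieldType) n (A : 'M[F]_n) (s : seq F) a :
    diagonalizable A -> char_poly A = \prod_(b <- s) ('X - b%:P) ->
  (count_mem a s <= \rank (eigenspace A a))%N.
Proof.
case=> P Punit /diagonalizable_forPex[D /(simmxP Punit) PA] cA.
have cD : char_poly A = \prod_(b <- [seq D 0 i | i <- enum 'I_n]) ('X - b%:P).
  rewrite big_map big_enum /=.
  have -> : \prod_(i < n) ('X - (D 0 i)%:P) = char_poly (diag_mx D).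
    rewrite char_poly_trig ?diag_mx_is_trig //.
    by apply: eq_bigr => i _; rewrite mxE eqxx mulr1n.
  have detP0 : \det (map_mx polyC P) != 0.
    by rewrite det_map_mx polyC_eq0 -unitfE -unitmxE.
  apply: (mulfI detP0); rewrite -det_mulmx mulrC -det_mulmx.
  rewrite /char_poly_mx mulmxBr mulmxBl scalar_mxC.
  by rewrite -!map_mxM PA.
have /permP -> : perm_eq s [seq D 0 i | i <- enum 'I_n].
  by apply: prod_XsubC_eq; rewrite -cA.
pose I := [set i | D 0 i == a].
have -> : count_mem a [seq D 0 i | i <- enum 'I_n] = #|I|.
  rewrite count_map -size_filter cardE; congr size.
  by rewrite {2}/enum_mem -enumT; apply: eq_filter => i; rewrite /= inE.
pose B := rowsub (enum_val : 'I_#|I| -> _) P.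
have Bfree : row_free B.
  rewrite /B rowsubE /row_free mxrankMfree ?row_free_unit //.
  apply/row_freeP; exists (rowsub (enum_val : 'I_#|I| -> _) 1%:M)^T.
  apply/matrixP => i j; rewrite !mxE (bigD1 (enum_val i)) //= !mxE eqxx mul1r.
  rewrite big1 ?addr0 => [|k ki]; last by rewrite !mxE eq_sym (negPf ki) mul0r.
  by rewrite eq_sym (inj_eq enum_val_inj).
rewrite -[leqLHS](eqP Bfree); apply/mxrankS/eigenspaceP.
rewrite /B mul_rowsub_mx PA; apply/matrixP => i j.
rewrite mul_diag_mx !mxE; congr (_ * _).
by have := enum_valP i; rewrite inE => /eqP.
Qed.

Lemma selfadjoint_count_le (R : realFieldType) n (d : 'rV[R]_n)
    (A : 'M[R]_n) (s : seq R) a :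
    (forall i, 0 < d 0 i) -> diag_mx d *m A = A^T *m diag_mx d ->
    char_poly A = \prod_(b <- s) ('X - b%:P) ->
  (count_mem a s <= \rank (eigenspace A a))%N.
Proof.
case: n d A => [|n] d A d_gt0 symA cA; last first.
  exact: diagonalizable_count_le (selfadjoint_diagonalizable d_gt0 symA cA) cA.
have := congr1 (size : {poly R} -> nat) cA.
by rewrite size_char_poly size_prod_XsubC => -[/esym/size0nil->].
Qed.

(** The values [t = 1] and [t = -1] give [c >= 0], so [t = - b / (1 + c)] is legitimate; there the
    form equals [- (b / (1 + c)) ^ 2]. *)
Lemma quadratic_ge0_lin0 (R : realFieldType) (b c : R) :
  (forall t, 0 <= t * b + t ^+ 2 * c) -> b = 0.
Proof.
move=> H; have c_ge0 : 0 <= c by have := H 1; have := H (-1); nra.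
apply/eqP/negPn/negP => b0.
have e1 : (1 + c) != 0 by apply: lt0r_neq0; lra.
have := H (- b / (1 + c)).
have -> : - b / (1 + c) * b + (- b / (1 + c)) ^+ 2 * c = - (b / (1 + c)) ^+ 2.
  by field.
by rewrite oppr_ge0 leNgt exprn_even_gt0 //= mulf_neq0 ?invr_eq0.
Qed.

Section WeightedGraph.
Variables (R : rcfType) (V : finType) (w : V -> V -> R) (m : V -> R).
Hypotheses (Gwm : weighted_graph w m) (Gconn : connected w).

Local Notation Lap := (Lap w m).
Local Notation Gam := (Gam w m).
Local Notation Gam2 := (Gam2 w m).
Local Notation dist := (dist w).
Local Notation adj := (adj w).

Let wC x y : w x y = w y x. Proof. by case: Gwm. Qed.
Let w_ge0 x y : 0 <= w x y. Proof. by case: Gwm. Qed.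
Let m_gt0 x : 0 < m x. Proof. by case: Gwm. Qed.
Let m_neq0 x : m x != 0. Proof. by rewrite gt_eqF. Qed.

(** * Combinatorial distance *)

Lemma adjC x y : adj x y = adj y x.
Proof. by rewrite /Defs.adj wC. Qed.

Lemma adjxx x : adj x x = false.
Proof. by case: Gwm => _ _ wxx _; rewrite /Defs.adj wxx ltxx. Qed.

Lemma w_eq0 x y : ~~ adj x y -> w x y = 0.
Proof. by move=> nxy; apply/eqP; rewrite eq_le w_ge0 leNgt nxy. Qed.

Lemma reach_dist_le n x y : reach w n x y -> (dist x y <= n)%N.
Proof.
move=> xy; rewrite leqNgt; apply/negP => lt_n.
have := before_find 0%N lt_n.
have n_lt : (n < #|V|)%N.
  by apply: leq_trans lt_n _; rewrite -[leqRHS](size_iota 0) find_size.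
by rewrite nth_iota // xy.
Qed.

Lemma reach_path x p : path adj x p -> reach w (size p) x (last x p).
Proof.
elim: p x => //= y p IHp x /andP[xy yp].
by apply/orP; right; apply/existsP; exists y; rewrite xy IHp.
Qed.

(** A path without repeated vertices has fewer than [#|V|] edges, so the bounded search defining
    [dist] succeeds. *)
Lemma reach_dist x y : reach w (dist x y) x y.
Proof.
have /connectP[p xp ->] := Gconn x y; case/shortenP: xp => q xq uq _.
have q_lt : (size q < #|V|)%N.
  by have := max_card (mem (x :: q)); rewrite (card_uniqP uq).
have rq := reach_path xq.
have : has (fun n => reach w n x (last x q)) (iota 0 #|V|).
  by apply/hasP; exists (size q); rewrite ?mem_iota.
move=> h; have := nth_find 0%N h.
by rewrite nth_iota // -[ltnRHS](size_iota 0) -has_find.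
Qed.

Lemma distxx x : dist x x = 0%N.
Proof.
by apply/eqP; rewrite -leqn0; apply: reach_dist_le; rewrite /= eqxx.
Qed.

Lemma dist_eq0 x y : dist x y = 0%N -> x = y.
Proof. by move=> d0; have := reach_dist x y; rewrite d0 => /eqP. Qed.

Lemma dist_adj x y z : adj x y -> (dist x z <= (dist y z).+1)%N.
Proof.
move=> xy; apply: reach_dist_le => /=; apply/orP; right.
by apply/existsP; exists y; rewrite xy reach_dist.
Qed.

Lemma dist_succ x z n :
  dist x z = n.+1 -> exists2 y, adj x y & dist y z = n.
Proof.
move=> dx; have := reach_dist x z; rewrite dx /= => /orP[/reach_dist_le|].
  by rewrite dx ltnn.
case/existsP => y /andP[xy /reach_dist_le dy]; exists y => //.
by apply/eqP; rewrite eqn_leq dy -ltnS -dx dist_adj.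
Qed.

(** * Calculus of [Lap], [Gam] and [Gam2] *)

Lemma eq_Lap f g : f =1 g -> Lap f =1 Lap g.
Proof.
by move=> fg x; congr (_ * _); apply: eq_bigr => y _; rewrite !fg.
Qed.

Lemma Lap_lin f t g x :
  Lap (fun z => f z + t * g z) x = Lap f x + t * Lap g x.
Proof.
rewrite /Defs.Lap [X in _ = _ + X]mulrCA -mulrDr; congr (_ * _).
by rewrite mulr_sumr -big_split /=; apply: eq_bigr => y _; ring.
Qed.

(** The weight [m] cancels, and exchanging the two sums uses the symmetry of [w]. *)
Lemma sum_Lap f : \sum_x m x * Lap f x = 0.
Proof.
have E : \sum_x m x * Lap f x = \sum_x \sum_y w x y * (f y - f x).
  by apply: eq_bigr => x _; rewrite mulVKf.
rewrite E; under eq_bigr => x _ do under eq_bigr => y _ do rewrite mulrBr.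
under eq_bigr do rewrite sumrB.
rewrite sumrB [X in X - _]exchange_big /=; apply/eqP; rewrite subr_eq0.
by apply/eqP; apply: eq_bigr => x _; apply: eq_bigr => y _; rewrite wC.
Qed.

Lemma GamE f g x :
  Gam f g x = (m x)^-1 * (\sum_y w x y * ((f y - f x) * (g y - g x))) / 2.
Proof.
rewrite /Defs.Gam /Defs.Lap; congr (_ / 2).
rewrite ![_ x * ((m x)^-1 * _)]mulrCA -!mulrBr; congr (_ * _).
by rewrite !mulr_sumr -!sumrB; apply: eq_bigr => y _; ring.
Qed.

Lemma GamC f g x : Gam f g x = Gam g f x.
Proof.
by rewrite !GamE; congr (_ * _ / _); apply: eq_bigr => y _; rewrite (mulrC (f y - _)).
Qed.

Lemma eq_Gam f f' g g' : f =1 f' -> g =1 g' -> Gam f g =1 Gam f' g'.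
Proof.
move=> ff' gg' x; rewrite !GamE; congr (_ * _ / _).
by apply: eq_bigr => y _; rewrite !ff' !gg'.
Qed.

Lemma Gam_linl f t g h x :
  Gam (fun z => f z + t * g z) h x = Gam f h x + t * Gam g h x.
Proof.
rewrite !GamE mulrA -mulrDl [X in (_ + X) / 2]mulrCA -mulrDr.
congr (_ * _ / _); rewrite mulr_sumr -big_split /=.
by apply: eq_bigr => y _; ring.
Qed.

Lemma Gam_linr f t g h x :
  Gam h (fun z => f z + t * g z) x = Gam h f x + t * Gam h g x.
Proof. by rewrite GamC Gam_linl !(GamC h). Qed.

Lemma Gam2_sqrD f t g x :
  Gam2 (fun z => f z + t * g z) (fun z => f z + t * g z) x =
  Gam2 f f x + 2 * t * Gam2 f g x + t ^+ 2 * Gam2 g g x.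
Proof.
set h := fun z => _; rewrite /Defs.Gam2.
have -> : Lap (Gam h h) x =
    Lap (fun z => (Gam f f z + (2 * t) * Gam f g z) + t ^+ 2 * Gam g g z) x.
  apply: eq_Lap => z; rewrite Gam_linl !Gam_linr (GamC g f); ring.
rewrite !Lap_lin.
have -> : Gam h (Lap h) x = Gam h (fun z => Lap f z + t * Lap g z) x.
  by apply: eq_Gam => // z; rewrite Lap_lin.
rewrite Gam_linr !Gam_linl; ring.
Qed.

Lemma Gam_sqrD f t g x :
  Gam (fun z => f z + t * g z) (fun z => f z + t * g z) x =
  Gam f f x + 2 * t * Gam f g x + t ^+ 2 * Gam g g x.
Proof. by rewrite Gam_linl !Gam_linr (GamC g f); ring. Qed.

Lemma Gam_ge0 f x : 0 <= Gam f f x.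
Proof.
rewrite GamE mulr_ge0 ?invr_ge0 // mulr_ge0 ?invr_ge0 ?(ltW (m_gt0 x)) //.
by apply: sumr_ge0 => y _; rewrite mulr_ge0 // -expr2 sqr_ge0.
Qed.

Lemma Gam_eq0 f x y : Gam f f x = 0 -> adj x y -> f y = f x.
Proof.
move=> /eqP; rewrite GamE !mulf_eq0 invr_eq0 (negPf (m_neq0 x)) invr_eq0.
rewrite pnatr_eq0 orbF /= psumr_eq0 => [/allP/(_ y (mem_index_enum _)) + xy|z _].
  by rewrite /= mulf_eq0 gt_eqF //= -expr2 sqrf_eq0 subr_eq0 => /eqP.
by rewrite mulr_ge0 // -expr2 sqr_ge0.
Qed.

Lemma Gam_eq0_const f : (forall x, Gam f f x = 0) -> forall x y, f x = f y.
Proof.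
move=> G0 x y; have /connectP[p xp ->] := Gconn x y.
elim: p x xp => //= z p IHp x /andP[xz zp].
by rewrite -(IHp z zp) (Gam_eq0 (G0 x) xz).
Qed.

(** Integration by parts: the term [Lap (f * f)] of [Gam f f] integrates to 0. *)
Lemma sum_Gam f : \sum_x m x * Gam f f x = - \sum_x m x * (f x * Lap f x).
Proof.
have E x : m x * Gam f f x =
    (m x * Lap (fun z => f z * f z) x) / 2 - m x * (f x * Lap f x).
  by rewrite /Defs.Gam; field.
by rewrite (eq_bigr _ (fun x _ => E x)) sumrB -mulr_suml sum_Lap mul0r add0r.
Qed.

Lemma sum_Gam_eq0 f : \sum_x m x * Gam f f x = 0 -> forall x y, f x = f y.
Proof.
move=> /eqP; rewrite psumr_eq0 => [/allP H|x _]; last first.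
  by rewrite mulr_ge0 ?Gam_ge0 ?(ltW (m_gt0 x)).
apply: Gam_eq0_const => x; apply/eqP.
by have := H x (mem_index_enum _); rewrite /= mulf_eq0 (negPf (m_neq0 x)).
Qed.

Lemma harmonic_const f : (forall x, Lap f x = 0) -> forall x y, f x = f y.
Proof.
move=> H; apply: sum_Gam_eq0; rewrite sum_Gam big1 ?oppr0 // => x _.
by rewrite H !mulr0.
Qed.

(** * Eigenfunctions and their integrated identities *)

(** The sign makes [a] an eigenvalue of the negative Laplacian; [f = 0] is allowed. *)
Definition eigenfun a f := forall x, Lap f x = - a * f x.

Lemma eigenfun_Gam a f g x : eigenfun a f -> Gam g (Lap f) x = - a * Gam g f x.
Proof.
move=> fa; have -> : Gam g (Lap f) x = Gam g (fun z => 0 + - a * f z) x.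
  by apply: eq_Gam => // z; rewrite add0r fa.
rewrite Gam_linr -[RHS]add0r; congr (_ + _).
by rewrite GamE big1 ?mulr0 ?mul0r // => y _; rewrite subrr !mulr0.
Qed.

Lemma eigenfun_Gam2 a f x :
  eigenfun a f -> Gam2 f f x = Lap (Gam f f) x / 2 + a * Gam f f x.
Proof. by move=> fa; rewrite /Defs.Gam2 !(eigenfun_Gam _ _ fa); field. Qed.

Lemma sum_Gam2 a f : eigenfun a f ->
  \sum_x m x * Gam2 f f x = a * \sum_x m x * Gam f f x.
Proof.
move=> fa.
have E x : m x * Gam2 f f x = (m x * Lap (Gam f f) x) / 2 + a * (m x * Gam f f x).
  by rewrite (eigenfun_Gam2 _ fa); ring.
rewrite (eq_bigr _ (fun x _ => E x)) big_split /= -mulr_suml sum_Lap mul0r add0r.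
by rewrite mulr_sumr.
Qed.

Lemma eigenfun_const0 a f : a != 0 -> eigenfun a f ->
  (forall x y, f x = f y) -> forall x, f x = 0.
Proof.
move=> a0 fa fC x; have /eqP := fa x; rewrite /Defs.Lap big1.
  by rewrite mulr0 eq_sym mulf_eq0 oppr_eq0 (negPf a0) => /eqP.
by move=> y _; rewrite (fC y x) subrr mulr0.
Qed.

(** * Consequences of the curvature bound *)

Section Curvature.
Variable K : R.
Hypotheses (K_gt0 : 0 < K) (GCD : CD w m K).

(** Integrating the curvature bound gives [K * I <= a * I] for the energy [I], the integral of
    [Gam f f]. As [a < K] and [I >= 0], the energy vanishes and [f] is constant. *)
Lemma lichnerowicz a f :
  a != 0 -> a < K -> eigenfun a f -> forall x, f x = 0.
Proof.
move=> a0 aK fa; apply: (eigenfun_const0 a0 fa); apply: sum_Gam_eq0.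
apply/le_anti/andP; split; last first.
  by apply: sumr_ge0 => x _; rewrite mulr_ge0 ?Gam_ge0 ?(ltW (m_gt0 x)).
have : K * \sum_x m x * Gam f f x <= a * \sum_x m x * Gam f f x.
  rewrite -(sum_Gam2 fa) mulr_sumr; apply: ler_sum => x _.
  by rewrite mulrCA ler_wpM2l ?GCD ?(ltW (m_gt0 x)).
by rewrite -subr_ge0 -mulrBl nmulr_rge0 // subr_lt0.
Qed.

(** Equality case of the integrated bound: the nonnegative defects [Gam2 - K * Gam] have weighted
    sum 0. *)
Lemma eigenfunK_Gam2 f x : eigenfun K f -> Gam2 f f x = K * Gam f f x.
Proof.
move=> fK; have : \sum_x m x * (Gam2 f f x - K * Gam f f x) == 0.
  rewrite (eq_bigr _ (fun x _ => mulrBr (m x) _ _)) sumrB (sum_Gam2 fK) mulr_sumr.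
  by rewrite -sumrB big1 // => z _; ring.
rewrite psumr_eq0 => [/allP/(_ x (mem_index_enum _))|z _].
  by rewrite /= mulf_eq0 (negPf (m_neq0 x)) subr_eq0 => /eqP.
by rewrite mulr_ge0 ?subr_ge0 ?GCD ?(ltW (m_gt0 z)).
Qed.

Lemma eigenfunK_Gam_const f : eigenfun K f -> forall x y, Gam f f x = Gam f f y.
Proof.
move=> fK; apply: harmonic_const => x.
by have := eigenfunK_Gam2 x fK; rewrite (eigenfun_Gam2 _ fK); lra.
Qed.

(* [f] minimises the nonnegative quadratic form [Gam2 - K Gam], hence lies in
   the radical of its polarisation. *)
Lemma eigenfunK_Gam2_polar f g x : eigenfun K f -> Gam2 f g x = K * Gam f g x.
Proof.
move=> fK; apply/eqP; rewrite -subr_eq0; apply/eqP.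
(* Perturbing by [t / 2] makes the linear coefficient exactly the wanted difference; this produces
   the factor [1 / 4] on the quadratic one. *)
apply: (@quadratic_ge0_lin0 _ _ ((Gam2 g g x - K * Gam g g x) / 4)) => t.
have := GCD (fun z => f z + t / 2 * g z) x.
rewrite Gam2_sqrD Gam_sqrD (eigenfunK_Gam2 x fK) -subr_ge0 => H.
by apply: (le_trans H); rewrite le_eqVlt; apply/orP; left; apply/eqP; field.
Qed.

(** With [g] the indicator of [z], [Gam f g x] and [Gam (Lap f) g x] vanish because [w x z = 0]. The
    polarised identity leaves only [Lap (Gam f g) x = Gam f (Lap g) x]. *)
Lemma eigenfunK_dist2 f x z : eigenfun K f -> x != z -> w x z = 0 ->
  \sum_y w x y * w y z / m y * (f z - 2 * f y + f x) = 0.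
Proof.
move=> fK xz wxz; pose g y : R := (y == z)%:R.
have Lg y : y != z -> Lap g y = w y z / m y.
  move=> yz; rewrite /Defs.Lap (bigD1 z) //= /g eqxx (negPf yz) subr0 mulr1.
  rewrite big1 ?addr0 1?mulrC // => u uz.
  by rewrite (negPf uz) subr0 mulr0.
have Gg y : y != z -> Gam f g y = w y z / m y * (f z - f y) / 2.
  move=> yz; rewrite GamE (bigD1 z) //= /g eqxx (negPf yz) subr0 mulr1.
  rewrite big1 ?addr0 => [|u uz]; last by rewrite (negPf uz) subr0 !mulr0.
  by rewrite mulrA (mulrC (m y)^-1).
have := eigenfunK_Gam2_polar g x fK; rewrite /Defs.Gam2 (GamC g).
have -> : Gam (Lap f) g x = - K * Gam f g x by rewrite GamC (eigenfun_Gam _ _ fK) GamC.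
have G0 : Gam f g x = 0 by rewrite Gg // wxz !mul0r.
rewrite G0 !mulr0 subr0 => /eqP; rewrite mulf_eq0 invr_eq0 pnatr_eq0 orbF.
rewrite GamE /Defs.Lap -mulrA -mulrBr mulf_eq0 invr_eq0 (negPf (m_neq0 x)) /=.
rewrite mulr_suml -sumrB => /eqP H.
apply: etrans (etrans (congr1 ( *%R 2) H) (mulr0 _)).
rewrite mulr_sumr; apply: eq_bigr => y _; rewrite -!/(Lap g _) G0.
(* The formulas [Lg] and [Gg] fail at [z], but that summand carries the factor [w x z = 0]. *)
have [->|yz] := eqVneq y z; first by rewrite wxz !mul0r subr0 mulr0.
by rewrite Gg // !Lg // wxz mul0r; field.
Qed.

(** * From the matrix spectrum to eigenfunctions *)

(* A left eigenvector [v] of the matrix corresponds to the eigenfunction [v / m]. *)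
Definition row_fun (v : 'rV[R]_#|V|) (x : V) : R := v 0 (enum_rank x) / m x.

Lemma eigenspace_eigenfun a (v : 'rV[R]_#|V|) :
  (v <= eigenspace (negLap_mx w m) a)%MS -> eigenfun a (row_fun v).
Proof.
move=> /eigenspaceP/rowP va x; have := va (enum_rank x); rewrite !mxE.
rewrite (reindex (@enum_rank V)) /=; last exact/onW_bij/enum_rank_bij.
have E y : v 0 (enum_rank y) = row_fun v y * m y by rewrite /row_fun mulfVK.
under eq_bigr => y _ do
  rewrite !mxE !enum_rankK (inj_eq enum_rank_inj) mulrBr E.
rewrite sumrB (bigD1 x) //= eqxx mul1r big1 ?addr0 => [|y yx]; last first.
  by rewrite (negPf yx) mul0r mulr0.
have S : \sum_y row_fun v y * m y * (w y x / m y) = \sum_y w x y * row_fun v y.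
  by apply: eq_bigr => y _; rewrite wC -mulrA [m y * _]mulrC mulfVK // mulrC.
rewrite E /Deg mulrA mulrAC mulfK // S => H; apply: (mulfI (m_neq0 x)).
have -> : m x * Lap (row_fun v) x =
    \sum_y w x y * row_fun v y - row_fun v x * \sum_y w x y.
  rewrite /Defs.Lap mulVKf // mulr_sumr -sumrB.
  by apply: eq_bigr => y _; ring.
by lra.
Qed.

Lemma row_fun_eq0 (v : 'rV[R]_#|V|) : (forall x, row_fun v x = 0) -> v = 0.
Proof.
move=> v0; apply/rowP => i; have /eqP := v0 (enum_val i).
by rewrite /row_fun enum_valK mulf_eq0 invr_eq0 (negPf (m_neq0 _)) orbF mxE => /eqP.
Qed.

Lemma negLap_selfadjoint :
  let d := \row_i m (enum_val i) in
  diag_mx d *m negLap_mx w m = (negLap_mx w m)^T *m diag_mx d.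
Proof.
apply/matrixP => i j; rewrite mul_diag_mx mul_mx_diag !mxE.
have [->|ij] := eqVneq i j; first by rewrite mulrC.
by rewrite /= !mul0r !sub0r mulrN mulNr mulrCA divff // mulfVK // mulr1 wC.
Qed.

Lemma negLap_count_le s a : eigen_list w m s ->
  (count_mem a s <= \rank (eigenspace (negLap_mx w m) a))%N.
Proof.
case=> _; apply: selfadjoint_count_le negLap_selfadjoint => i.
by rewrite mxE.
Qed.

Lemma eigen_list_eigenvector s a : eigen_list w m s -> a \in s ->
  exists2 v : 'rV_#|V|, (v <= eigenspace (negLap_mx w m) a)%MS & v != 0.
Proof.
move=> hs; rewrite -has_pred1 has_count => a_s.
apply/rowV0Pn; rewrite -mxrank_eq0 -lt0n.
exact: leq_trans a_s (negLap_count_le a hs).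
Qed.

(** Harmonic functions are constant, so every left null vector is a multiple of [m]. *)
Lemma negLap_count0 s : eigen_list w m s -> (count_mem 0%R s <= 1)%N.
Proof.
move=> hs; apply: leq_trans (negLap_count_le 0 hs) _.
apply: leq_trans (rank_leq_row (\row_i m (enum_val i))); apply: mxrankS.
apply/rV_subP => v /eigenspace_eigenfun v0.
have vC : forall x y, row_fun v x = row_fun v y.
  by apply: harmonic_const => x; rewrite v0 oppr0 mul0r.
have [i|] := pickP 'I_#|V|; last first.
  by move=> noi; rewrite (_ : v = 0) ?sub0mx //; apply/rowP => i; have := noi i.
move=> _; apply/sub_rVP; exists (row_fun v (enum_val i)); apply/rowP => j.
by rewrite !mxE (vC _ (enum_val j)) /row_fun enum_valK mulfVK.
Qed.

(** The first [deg_max + 1] entries of the sorted list are at most [K], hence each is 0 or [K] by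
    [lichnerowicz]; at most one of them is 0. *)
Lemma negLap_countK s : eigen_list w m s ->
  nth 0 s (deg_max w) = K -> (deg_max w <= count_mem K s)%N.
Proof.
set n := deg_max w => hs sK; have [s_sorted _] := hs.
have n_lt : (n < size s)%N.
  (* Out of range, [nth] would return its default 0, contradicting [K > 0]. *)
  by rewrite ltnNge; apply: contraTN K_gt0 => /(nth_default 0); rewrite sK => ->; rewrite ltxx.
have s0K a : a \in take n.+1 s -> (a == 0) || (a == K).
  move=> as_; have a_s := mem_take as_; have aK : a <= K.
    move/(nthP 0): as_ => [i]; rewrite size_takel // => i_n <-.
    rewrite nth_take // -sK; apply: sorted_leq_nth; rewrite ?inE //.
    - exact: le_trans.
    - exact: leq_trans i_n n_lt.
  apply/norP => -[a0 a_K]; have [v va /negP[]] := eigen_list_eigenvector hs a_s.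
  apply/eqP/row_fun_eq0; apply: (lichnerowicz a0) (eigenspace_eigenfun va).
  by rewrite lt_neqAle a_K.
rewrite -(leq_add2l 1) add1n; apply: leq_trans (leq_add (negLap_count0 hs) (leqnn _)).
rewrite -[in leqRHS](cat_take_drop n.+1 s) !count_cat addnACA.
apply: leq_trans (leq_addr _ _).
rewrite -count_predUI [X in (_ + X)%N](@eq_count _ _ pred0) ?count_pred0 ?addn0.
  have := introT allP s0K; rewrite all_count size_takel // => /eqP cE.
  by apply: (leq_trans (eq_leq (esym cE))); apply/eq_leq/eq_count.
by move=> a /=; apply/negP => /andP[/eqP-> /eqP K0]; move: K_gt0; rewrite -K0 ltxx.
Qed.

(** * Eigenfunctions growing with the distance *)

Lemma exists_eigenfun_step s x : eigen_list w m s ->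
    nth 0 s (deg_max w) = K ->
  exists2 f, eigenfun K f & forall y, adj y x -> f y = f x + 1.
Proof.
move=> hs sK; pose E := eigenspace (negLap_mx w m) K.
pose N := [set y | adj y x].
(* [T] sends a row vector to the differences of its function along the edges at [x]. *)
pose T : 'M[R]_(#|V|, #|N|) := \matrix_(i, k)
  ((i == enum_rank (enum_val k))%:R / m (enum_val k) - (i == enum_rank x)%:R / m x).
have TE (v : 'rV_#|V|) k : (v *m T) 0 k = row_fun v (enum_val k) - row_fun v x.
  have sum1 z : \sum_i v 0 i * ((i == enum_rank z)%:R / m z) = row_fun v z.
    rewrite (bigD1 (enum_rank z)) //= eqxx mul1r big1 ?addr0 // => i iz.
    by rewrite (negPf iz) mul0r mulr0.
  by rewrite mxE; under eq_bigr do rewrite mxE mulrBr; rewrite sumrB !sum1.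
(* If these differences vanish, then [Gam f f] is 0 at [x], hence everywhere, and [f] is a constant
   eigenfunction for [K], so 0. *)
have Einj : (E :&: kermx T)%MS == 0.
  apply/rowV0P => v; rewrite sub_capmx => /andP[/eigenspace_eigenfun vK].
  move=> /sub_kermxP vT0; apply: row_fun_eq0.
  apply: (eigenfun_const0 (lt0r_neq0 K_gt0) vK); apply: Gam_eq0_const => y.
  rewrite (eigenfunK_Gam_const vK y x) GamE big1 ?mulr0 ?mul0r // => z _.
  have [xz|/w_eq0->] := boolP (adj x z); last by rewrite mul0r.
  have zN : z \in N by rewrite inE adjC.
  have /rowP/(_ (enum_rank_in zN z)) := vT0; rewrite TE enum_rankK_in // mxE => ->.
  by rewrite mul0r mulr0.
(* An injective map from dimension at least [deg_max] to dimension [deg x] is onto. *)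
have Tfull : row_full (E *m T).
  rewrite /row_full eqn_leq rank_leq_col; move/mxrank_injP: Einj => ->.
  apply: leq_trans (negLap_count_le K hs).
  by apply: leq_trans (negLap_countK hs sK); apply: (leq_bigmax x).
have [B BT] := row_fullP Tfull.
(* A preimage under [T], inside the eigenspace, of the all-ones vector. *)
pose v : 'rV_#|V| := const_mx 1 *m B *m E.
have vK : eigenfun K (row_fun v) by apply: eigenspace_eigenfun; rewrite submxMl.
exists (row_fun v) => // y yx; have yN : y \in N by rewrite inE.
have := TE v (enum_rank_in yN y); rewrite enum_rankK_in // /v -[_ *m T]mulmxA
  -[_ *m (E *m T)]mulmxA BT.
by rewrite mulmx1 mxE => /eqP; rewrite eq_sym subr_eq addrC => /eqP.
Qed.

(** Strong induction on the distance. For [z] at distance [k + 2], take [u] two steps closer: all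
    common neighbours of [u] and [z] lie at distance [k + 1], so [eigenfunK_dist2] determines
    [f z]. *)
Lemma eigenfun_step_dist f x : eigenfun K f ->
    (forall y, adj y x -> f y = f x + 1) ->
  forall z, f z = f x + (dist z x)%:R.
Proof.
move=> fK fx z; have [n dz] := ubnP (dist z x); elim: n => // n IHn in z dz *.
case dzE: (dist z x) => [|[|k]]; first by rewrite (dist_eq0 dzE) addr0.
  have [y zy /dist_eq0 yx] := dist_succ dzE.
  by rewrite fx // -yx.
have [y zy dy] := dist_succ dzE; have [u yu du] := dist_succ dy.
have uz : u != z by apply: contra_eq_neq dzE => <-; rewrite du; lia.
have uzN : ~~ adj u z.
  by apply/negP; rewrite adjC => /(dist_adj x); rewrite dzE du; lia.
have := eigenfunK_dist2 fK uz (w_eq0 uzN).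
have fE t : w u t * w t z / m t * (f z - 2 * f t + f u) =
    w u t * w t z / m t * (f z - (f x + k.+2%:R)).
  have [ut|/w_eq0->] := boolP (adj u t); last by rewrite !mul0r.
  have [tz|/w_eq0->] := boolP (adj t z); last by rewrite mulr0 !mul0r.
  have dt : dist t x = k.+1.
    rewrite adjC in tz; have := dist_adj x tz; rewrite adjC in ut.
    by have := dist_adj x ut; rewrite dzE du; lia.
  rewrite (IHn t) ?(IHn u) ?dt ?du; try lia.
  by congr (_ * _); rewrite -addn2 -(addn1 k) !natrD; ring.
(* The total weight is nonzero because the path through [y] contributes a positive term. *)
rewrite (eq_bigr _ (fun t _ => fE t)) -mulr_suml => /eqP; rewrite mulf_eq0.
case/orP => [|/eqP/subr0_eq //]; rewrite psumr_eq0 => [/allP|t _].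
  move=> /(_ y (mem_index_enum _)) /=; rewrite gt_eqF // divr_gt0 ?mulr_gt0 //.
    by rewrite adjC in yu.
  by rewrite adjC in zy.
by rewrite divr_ge0 ?mulr_ge0 ?(ltW (m_gt0 t)).
Qed.

(** * Shell structure and edge degree *)

Lemma eigen_step_HSS :
    (forall x, exists2 f, eigenfun K f & forall y, adj y x -> f y = f x + 1) ->
    (1 < #|V|)%N ->
  forall x0, HSS w m (2 * Deg_max w m / K) (K / 2) x0.
Proof.
move=> step V_gt1.
have {}step x : exists2 f, eigenfun K f & forall z, f z = f x + (dist z x)%:R.
  have [f fK fx] := step x; exists f => //; exact: eigenfun_step_dist fK fx.
have LapE f x : Lap f x = \sum_y w x y / m x * (f y - f x).
  by rewrite /Defs.Lap mulr_sumr; apply: eq_bigr => y _; ring.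
have DegE x : Deg w m x = \sum_y w x y / m x by rewrite /Deg mulr_suml.
(* [Gam f f] is constant and equals [Deg x0 / 2] at [x0]. *)
have Deg_ne x0 x : Deg w m x0 = \sum_(y | dist y x0 != dist x x0) w x y / m x.
  have [f fK fd] := step x0; have := eigenfunK_Gam_const fK x0 x.
  have GE z : Gam f f z = (\sum_(y | dist y x0 != dist z x0) w z y / m z) / 2.
    rewrite GamE mulr_sumr [in RHS]big_mkcond /=; congr (_ / _); apply: eq_bigr => y _.
    have [yz|/w_eq0->] := boolP (adj z y); last by rewrite !mul0r mulr0 if_same.
    have [d1 yz'] : (dist z x0 <= (dist y x0).+1)%N /\ adj y z.
      by rewrite dist_adj // adjC.
    have d2 : (dist y x0 <= (dist z x0).+1)%N by rewrite dist_adj.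
    rewrite !(fd y) !(fd z) opprD addrACA subrr add0r.
    case: ltngtP => [dyz|dzy|->]; last by rewrite subrr !mulr0.
      have -> : dist z x0 = (dist y x0).+1 by lia.
      by rewrite -addn1 natrD; ring.
    have -> : dist y x0 = (dist z x0).+1 by lia.
    by rewrite -addn1 natrD; ring.
  rewrite !GE => /(mulIf _) <-; last by rewrite invr_eq0 pnatr_eq0.
  rewrite DegE [RHS]big_mkcond; apply: eq_bigr => y _; rewrite distxx.
  have [/dist_eq0->|//] := eqVneq (dist y x0) 0%N.
  by rewrite w_eq0 ?adjxx ?mul0r.
(* The excess of [Deg x] over [Deg x0] is the weight of the edges from [x] inside its own shell.
   Exchanging [x] and [x0] then forces equality, so no such edge exists. *)
have DegS x0 x : Deg w m x = Deg w m x0 +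
    \sum_(y | dist y x0 == dist x x0) w x y / m x.
  by rewrite (Deg_ne x0 x) DegE (bigID (fun y => dist y x0 == dist x x0)) /= addrC.
have p_ge0 x y : 0 <= w x y / m x by rewrite divr_ge0 ?(ltW (m_gt0 x)).
have Deg_le x0 x : Deg w m x0 <= Deg w m x.
  by rewrite (DegS x0 x) lerDl sumr_ge0.
have DegC x0 x : Deg w m x0 = Deg w m x by apply/le_anti; rewrite !Deg_le.
have Deg_maxE x : Deg w m x = Deg_max w m.
  rewrite /Deg_max; apply/le_anti/andP; split; first exact: le_bigmax.
  apply/bigmax_leP; split => [|y _]; last exact: Deg_le.
  by rewrite DegE sumr_ge0.
have dist_ne x0 x y : adj x y -> dist y x0 != dist x x0.
  move=> xy; apply/negP => dxy; have := DegS x0 x; rewrite (DegC x0 x) => /eqP.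
  rewrite -[X in X == _]addr0 (inj_eq (addrI _)) eq_sym psumr_eq0 // => /allP.
  move=> /(_ y (mem_index_enum _)); rewrite dxy mulf_eq0 invr_eq0.
  by rewrite (negPf (m_neq0 x)) gt_eqF.
have K_neq0 := lt0r_neq0 K_gt0.
move=> x0; have D_gt0 : 0 < Deg_max w m.
  have [x xx0] : exists x, x != x0.
    have /card_gt1P[y [z [_ _ yz]]] := V_gt1.
    have [yx0|] := eqVneq y x0; [exists z | by exists y].
    by rewrite -yx0 eq_sym.
  have := erefl (dist x x0); case: {2}(dist x x0) => [/dist_eq0 e|n].
    by rewrite e eqxx in xx0.
  move=> /dist_succ[y xy _]; rewrite -(Deg_maxE x) DegE.
  by rewrite (bigD1 y) //= ltr_pwDl ?divr_gt0 ?sumr_ge0.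
split=> [||x||x].
- by rewrite divr_gt0 ?mulr_gt0.
- by rewrite divr_gt0.
- by rewrite Deg_maxE; field.
(* Adjacent vertices have distances to [x0] differing by exactly 1, so parity is a proper
   colouring. *)
- exists (fun x => odd (dist x x0)) => x y xy.
  have := dist_ne x0 x y xy; have := dist_adj x0 xy.
  by rewrite adjC in xy; have := dist_adj x0 xy; lia.
have [f fK fd] := step x0.
(* Edges away from [x0] count [+1] and edges towards it [-1]. At [x0] this gives
   [- K * f x0 = Deg_max]; subtracting it from the equation at [x] yields condition (iii). *)
have Lpm z : Lap f z = Deg w m z - 2 * dminus w m x0 z.
  rewrite LapE DegE /dminus mulr_sumr [X in _ - X]big_mkcond -sumrB.
  apply: eq_bigr => y _; rewrite (adjC y) (wC y).
  have [zy|/w_eq0->] := boolP (adj z y); last by rewrite /= !mul0r subrr.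
  have := dist_ne x0 z y zy; have := dist_adj x0 zy; rewrite adjC in zy.
  have := dist_adj x0 zy; rewrite !(fd y) !(fd z) /=.
  case: ltngtP => // dzy dy dz _.
    have -> : dist z x0 = (dist y x0).+1 by lia.
    by rewrite -addn1 natrD; ring.
  have -> : dist y x0 = (dist z x0).+1 by lia.
  by rewrite -addn1 natrD; ring.
have := Lpm x0; have := Lpm x; rewrite !fK !Deg_maxE (fd x).
have -> : dminus w m x0 x0 = 0 by rewrite /dminus distxx big_pred0 // => y; rewrite andbF.
by lra.
Qed.

(** For an edge [x y], take [y] as base point: [y] is the only vertex closer to it than [x], so
    [dminus] at [x] is the single term [w x y / m x]. *)
Lemma HSS_const_edge_degree N W :
  (forall x0, HSS w m N W x0) -> 0 < W -> const_edge_degree w m.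
Proof.
move=> hss W_gt0; exists W; split=> // x y.
have [xy|/w_eq0->] := boolP (adj x y); last by left; rewrite mul0r.
right; have [_ _ _ _ /(_ x)] := hss y.
have dxy : dist x y = 1%N.
  apply/eqP; rewrite eqn_leq -[in X in X && _](distxx y) dist_adj //= lt0n.
  by apply: contraTneq xy => /dist_eq0->; rewrite adjxx.
rewrite dxy mulr1 => <-; rewrite /dminus (bigD1 y) /=; last by rewrite adjC xy distxx dxy.
rewrite wC big1 ?addr0 // => z /andP[/andP[_]].
by rewrite dxy ltnS leqn0 => /eqP/dist_eq0->; rewrite eqxx.
Qed.

(** On a single vertex every function is constant, so [K] would have no eigenvector. Two vertices
    are what makes [Deg_max] positive. *)
Lemma card_gt1_of_eigenvalue s : eigen_list w m s -> K \in s -> (1 < #|V|)%N.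
Proof.
move=> hs /(eigen_list_eigenvector hs)[v /eigenspace_eigenfun vK v0].
rewrite ltnNge; apply: contra_neqN v0 => /fintype_le1P V1.
apply/row_fun_eq0/(eigenfun_const0 (lt0r_neq0 K_gt0) vK) => x y.
by rewrite (V1 x y).
Qed.

End Curvature.
End WeightedGraph.

Theorem theorem4 (R : rcfType) (V : finType) (w : V -> V -> R) (m : V -> R)
    (K : R) (s : seq R) :
  weighted_graph w m -> connected w -> (0 < #|V|)%N ->
  0 < K -> CD w m K ->
  eigen_list w m s ->
  nth 0 s (deg_max w) = K ->
  (forall x0 : V, HSS w m (2 * Deg_max w m / K) (K / 2) x0) /\
  const_edge_degree w m.
Proof.
move=> Gwm Gconn _ K_gt0 GCD hs sK.
have K_s : K \in s.
  rewrite -sK mem_nth // ltnNge; apply: contraTN K_gt0 => /(nth_default 0).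
  by rewrite sK => ->; rewrite ltxx.
have hss x0 : HSS w m (2 * Deg_max w m / K) (K / 2) x0.
  apply: (eigen_step_HSS Gwm Gconn K_gt0 GCD).
    by move=> x; apply: exists_eigenfun_step hs sK.
  exact: (card_gt1_of_eigenvalue Gwm K_gt0 hs K_s).
split; first exact: hss.
apply: (HSS_const_edge_degree Gwm Gconn hss).
by rewrite divr_gt0.
Qed.
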